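(* If $G$ is a split graph (a finite simple graph whose vertex set can be partitioned into a clique $X$ and an independent set $V(G)\setminus X$), then $\operatorname{tlir}(G) \leq 2$.
   Context: A total coloring of $G$ assigns a color to every vertex and every edge of $G$. For a color $c$ and a vertex $v$, the total $c$-degree of $v$ is the number of edges of color $c$ incident to $v$, plus $1$ if $v$ itself has color $c$. A total coloring is a locally irregular total coloring (TLIR coloring) if for every edge $uv$, with $c$ the color of $uv$, the total $c$-degrees of $u$ and $v$ differ. $\operatorname{tlir}(G)$ is the minimum number of colors in a TLIR coloring of $G$. *)

(* Defs.v *)
From mathcomp Require Import all_boot.

Set Implicit Arguments.
Unset Strict Implicit.
Unset Printing Implicit Defensive.

Record sgraph := SGraph {
  vertex :> finType;
  adj : rel vertex;
  adj_sym : symmetric adj;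
  adj_irrefl : irreflexive adj
}.

Definition edges (G : sgraph) : {set {set G}} :=
  [set [set p.1; p.2] | p : G * G & adj p.1 p.2].

Definition edge (G : sgraph) := {f : {set G} | f \in edges G}.

Definition clique (G : sgraph) (X : {set G}) : Prop :=
  {in X &, forall u v, u != v -> adj u v}.

Definition independent (G : sgraph) (X : {set G}) : Prop :=
  {in X &, forall u v, ~~ adj u v}.

Definition split_graph (G : sgraph) : Prop :=
  exists X : {set G}, clique X /\ independent (~: X).

(* The colors are 'I_k; not all of them need be used. *)
Definition total_coloring (G : sgraph) (k : nat) :=
  {ffun vertex G + edge G -> 'I_k}.

Definition total_degree (G : sgraph) (k : nat) (col : total_coloring G k)
    (c : 'I_k) (v : G) : nat :=
  #|[set f : edge G | (v \in val f) && (col (inr f) == c)]|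
  + (col (inl v) == c).

Definition is_tlir (G : sgraph) (k : nat) (col : total_coloring G k) : bool :=
  [forall f : edge G, forall u in val f, forall v in val f,
    (u != v) ==>
    (total_degree col (col (inr f)) u != total_degree col (col (inr f)) v)].

Definition tlir_colorable (G : sgraph) (k : nat) : bool :=
  [exists col : total_coloring G k, is_tlir col].

Lemma edge_nonempty (G : sgraph) (f : edge G) : exists u, u \in val f.
Proof.
by case: f => f /= /imsetP[p _ ->]; exists p.1; rewrite !inE eqxx.
Qed.

Lemma edge_eq (G : sgraph) (f : edge G) (u v : G) :
  u \in val f -> v \in val f -> u != v -> val f = [set u; v].
Proof.
case: f => f /= /imsetP[[a b] _ ->] /=; rewrite !inE.
by case/orP=> /eqP-> /orP[]/eqP->; rewrite ?eqxx // setUC.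
Qed.

(* Give each vertex its own color and each edge the color of one of its ends:
   every color class is then a star whose center has total degree at least 2
   and whose leaves have total degree 1. *)
Lemma tlir_colorable_card (G : sgraph) : tlir_colorable G #|G|.
Proof.
pose ctr (f : edge G) := xchoose (edge_nonempty f).
have ctrP f : ctr f \in val f by apply: xchooseP.
pose col : total_coloring G #|G| :=
  [ffun x => enum_rank (match x with inl v => v | inr f => ctr f end)].
have degE c v : total_degree col (enum_rank c) v =
    #|[set g : edge G | (v \in val g) && (ctr g == c)]| + (v == c).
  rewrite /total_degree !ffunE (inj_eq enum_rank_inj); congr (_ + _).
  by apply: eq_card => g; rewrite !inE ffunE (inj_eq enum_rank_inj).
have lt (f : edge G) w : w \in val f -> w != ctr f ->
    total_degree col (col (inr f)) w < total_degree col (col (inr f)) (ctr f).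
  move=> wf wc; rewrite ffunE !degE eqxx (negbTE wc) addn0 addn1 ltnS.
  apply: subset_leq_card; apply/subsetP => g; rewrite !inE => /andP[_ /eqP <-].
  by rewrite ctrP eqxx.
apply/existsP; exists col.
apply/forallP => f; apply/forall_inP => u uf; apply/forall_inP => v vf.
apply/implyP => uv.
have := ctrP f; rewrite {1}(edge_eq uf vf uv) !inE.
case/orP=> /eqP E.
  by rewrite neq_ltn; have := lt f v vf; rewrite E eq_sym => ->; rewrite ?orbT.
by rewrite neq_ltn; have := lt f u uf; rewrite E => ->.
Qed.

Lemma ex_tlir_colorable (G : sgraph) : exists k, tlir_colorable G k.
Proof. by exists #|G|; apply: tlir_colorable_card. Qed.

Definition tlir (G : sgraph) : nat := ex_minn (ex_tlir_colorable G).

(* Main.v *)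
(* Number the clique X as x_0, ..., x_(n-1) and let d x be the number of
   neighbours of x outside X.  Colour x_i x_j, and x_i itself when i = j, red
   iff i + j + 1 >= n: inside the clique x_i then has red degree i + 1 and blue
   degree n - i - 1.  Colour all edges leaving the clique at x_i red if
   i >= n/2 (rounded down) and blue otherwise.  If d is nonincreasing on the
   first half of X and nondecreasing on the second half, then the total red
   degrees still increase and the total blue degrees still decrease along X.
   A vertex outside X sends edges of one colour into one half of X only, too few
   to match the degree of a neighbour in that half; its own colour is chosen by
   the parity of n to absorb the rounding. *)
Require Import Defs.
From mathcomp Require Import all_boot.
From mathcomp Require Import zify.

Set Implicit Arguments.
Unset Strict Implicit.
Unset Printing Implicit Defensive.

(** The total [c]-degree for colors given on pairs of vertices rather than on the subtype [edge G];
    values of [g] at non-adjacent pairs do not count. *)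
Definition coldeg (G : sgraph) (C : eqType) (g : G -> G -> C) (h : G -> C)
    (c : C) (v : G) : nat :=
  #|[set w | adj v w & g v w == c]| + (h v == c).

Lemma edge_ends (G : sgraph) (f : edge G) :
  exists p : G * G, adj p.1 p.2 && (val f == [set p.1; p.2]).
Proof.
by case: f => f /= /imsetP[p]; rewrite inE => pP ->; exists p; rewrite pP eqxx.
Qed.

Lemma set2_inj (T : finType) (v : T) : injective (fun w => [set v; w]).
Proof.
move=> a b /setP E; have := E a; have := E b; rewrite !inE !eqxx !orbT.
by case: (eqVneq b v) => [->|_] /=; [rewrite orbb => _ /esym/eqP | move/eqP].
Qed.

(** Symmetry of [g] makes the choice of an order on the ends of an edge harmless, and [w] maps to
    [[set v; w]] bijectively from the neighbours of [v] to the edges at [v], so the two notions of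
    degree agree. *)
Lemma tlir_colorable_fun (G : sgraph) (k : nat)
    (g : G -> G -> 'I_k) (h : G -> 'I_k) :
  (forall u v, g u v = g v u) ->
  (forall u v, adj u v -> coldeg g h (g u v) u != coldeg g h (g u v) v) ->
  tlir_colorable G k.
Proof.
move=> gC gP.
pose ends (f : edge G) := xchoose (edge_ends f).
pose col : total_coloring G k :=
  [ffun x => match x with inl v => h v | inr f => g (ends f).1 (ends f).2 end].
have colE (f : edge G) u v : val f = [set u; v] -> adj u v /\ col (inr f) = g u v.
  rewrite ffunE; have /andP[] := xchooseP (edge_ends f); rewrite -/(ends f).
  case: (ends f) => a b /= ab /eqP-> E.
  have [av bv] : a \in [set u; v] /\ b \in [set u; v].
    by rewrite -E !inE !eqxx orbT.
  have ab' : a != b by apply: contraTneq ab => ->; rewrite adj_irrefl.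
  move: av bv ab ab'; rewrite !inE.
  case/orP=> /eqP-> /orP[]/eqP->; rewrite ?eqxx //.
  by rewrite adj_sym gC.
have degE c v : total_degree col c v = coldeg g h c v.
  rewrite /total_degree /coldeg !ffunE; congr (_ + _).
  rewrite -(card_imset _ val_inj) -[RHS](card_imset _ (@set2_inj _ v)).
  congr #|pred_of_set _|; apply/setP => A; apply/imsetP/imsetP.
    case=> f; rewrite inE => /andP[vf /eqP fc] ->.
    have [p /andP[_ /eqP fE]] := edge_ends f.
    have [w Ew] : exists w, val f = [set v; w].
      move: vf; rewrite fE !inE => /orP[] /eqP->; first by exists p.2.
      by exists p.1; rewrite setUC.
    have [vw cw] := colE f v w Ew.
    by exists w; rewrite // inE vw -cw fc eqxx.
  case=> w; rewrite inE => /andP[vw /eqP gc] ->.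
  have eP : [set v; w] \in edges G.
    by apply/imsetP; exists (v, w); rewrite ?inE.
  pose f : edge G := exist _ [set v; w] eP.
  have [_ cE] := colE f v w erefl.
  by exists f => //; rewrite inE cE gc !inE !eqxx.
apply/existsP; exists col.
apply/forallP => f; apply/forall_inP => u uf; apply/forall_inP => v vf.
apply/implyP => uv; have [auv ->] := colE f u v (edge_eq uf vf uv).
by rewrite !degE gP.
Qed.

(** With booleans in place of ['I_2], a color can be the truth value of a comparison. *)
Lemma tlir_colorable2_fun (G : sgraph) (g : G -> G -> bool) (h : G -> bool) :
  (forall u v, g u v = g v u) ->
  (forall u v, adj u v -> coldeg g h (g u v) u != coldeg g h (g u v) v) ->
  tlir_colorable G 2.
Proof.
move=> gC gP; pose enc (b : bool) : 'I_2 := inord b.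
have encE : {mono enc : a b / a == b}.
  by apply: inj_eq => -[] [] // /(congr1 val); rewrite /= !inordK.
apply: (@tlir_colorable_fun _ _ (fun u v => enc (g u v)) (enc \o h)) => [u v|].
  by rewrite gC.
have degE c v : coldeg (fun u v => enc (g u v)) (enc \o h) (enc c) v
    = coldeg g h c v.
  rewrite /coldeg /= encE; congr (_ + _).
  by apply: eq_card => w; rewrite !inE encE.
by move=> u v uv; rewrite !degE gP.
Qed.

(** Cut any enumeration of [X] at [k] and sort the two pieces by [d] in opposite directions. *)
Lemma valley_order (T : finType) (X : {set T}) (d : T -> nat) (k : nat) :
  exists s : seq T, [/\ uniq s, s =i X,
    {in X &, forall u v, index u s <= index v s < k -> d v <= d u} &
    {in X &, forall u v, k <= index u s <= index v s -> d u <= d v}].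
Proof.
pose e := enum X.
pose lo := sort (fun u v => d v <= d u) (take k e).
pose hi := sort (fun u v => d u <= d v) (drop k e).
have lo_tr : transitive (fun u v => d v <= d u).
  by move=> ? ? ? /[swap]; apply: leq_trans.
have hi_tr : transitive (fun u v => d u <= d v).
  by move=> ? ? ?; apply: leq_trans.
have lo_s : sorted (fun u v => d v <= d u) lo.
  by apply: sort_sorted => u v; apply: leq_total.
have hi_s : sorted (fun u v => d u <= d v) hi.
  by apply: sort_sorted => u v; apply: leq_total.
have sE : perm_eq (lo ++ hi) e.
  by rewrite -[e in X in perm_eq _ X](cat_take_drop k) perm_cat // perm_sort.
have sX : lo ++ hi =i X by move=> x; rewrite (perm_mem sE) mem_enum.
have size_lo : size lo <= k by rewrite size_sort size_take_min geq_minl.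
have idx w (r : seq T) : w \in r -> index w r < size r by rewrite index_mem.
exists (lo ++ hi); split=> //.
- by rewrite (perm_uniq sE) enum_uniq.
- move=> u v uX vX; have := sX u; have := sX v; rewrite uX vX !mem_cat !index_cat.
  (* [lo] falls short of [k] only when [X] is exhausted, so every index below [k] lies in [lo]. *)
  have hi0 : size lo < k -> hi = [::].
    rewrite size_sort size_take_min => lt; apply: size0nil.
    by rewrite size_sort size_drop; lia.
  case: ifP => [ulo|_]; case: ifP => [vlo|_] /=.
  + move=> _ _ /andP[le _].
    by apply: (sorted_leq_index lo_tr _ lo_s).
  + by move=> vhi _ /andP[_ lt]; move: vhi; rewrite hi0 //; lia.
  + by move=> _ _; have := idx v lo vlo; lia.
  + by move=> vhi _ /andP[_ lt]; move: vhi; rewrite hi0 //; lia.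
- move=> u v uX vX; have := sX u; have := sX v; rewrite uX vX !mem_cat !index_cat.
  case: ifP => [ulo|_]; first by move=> _ _; have := idx u lo ulo; lia.
  case: ifP => [vlo|_] /=; first by move=> _ _; have := idx v lo vlo; lia.
  move=> vhi uhi /andP[_]; rewrite leq_add2l => le.
  by apply: (sorted_leq_index hi_tr _ hi_s).
Qed.

Lemma card_index_lt (T : finType) (X : {set T}) (s : seq T) (m : nat) :
  uniq s -> s =i X -> m <= #|X| -> #|[set w in X | index w s < m]| = m.
Proof.
move=> s_uniq sX mX.
have sz : size s = #|X| by rewrite -(card_uniqP s_uniq); apply: eq_card.
rewrite -[RHS](@size_takel m _ s) ?sz // -(card_uniqP (take_uniq m s_uniq)).
apply: eq_card => w; rewrite !inE -sX.
case: (boolP (w \in s)) => [ws|/(contra (@mem_take _ _ _ _))/negbTE->//].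
by rewrite in_take.
Qed.

Lemma card_index_ge (T : finType) (X : {set T}) (s : seq T) (m : nat) :
  uniq s -> s =i X -> m <= #|X| -> #|[set w in X | m <= index w s]| = #|X| - m.
Proof.
move=> s_uniq sX mX; rewrite -[in RHS](card_index_lt s_uniq sX mX).
rewrite -[in RHS](cardsID [set w | index w s < m] X).
have -> : X :&: [set w | index w s < m] = [set w in X | index w s < m].
  by apply/setP => w; rewrite !inE.
by rewrite addKn; apply: eq_card => w; rewrite !inE -leqNgt andbC.
Qed.

Lemma split_tlir_colorable (G : sgraph) (X : {set G}) :
  clique X -> independent (~: X) -> tlir_colorable G 2.
Proof.
move=> cliqueX indepX; pose n := #|X|.
pose d x := #|[set w | adj x w & w \notin X]|.
have [s [s_uniq sX s_lo s_hi]] := valley_order X d n./2.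
pose ix v := index v s.
have ltX v : v \in X -> ix v < n.
  by rewrite -sX -index_mem -(card_uniqP s_uniq) (eq_card sX).
(* The weight n outside X makes the single threshold 2n encode both rules:
   2i + 1 + 2j + 1 >= 2n iff i + j + 1 >= n, and 2i + 1 + n >= 2n iff i >= n/2. *)
pose wt v := if v \in X then (ix v).*2.+1 else n.
pose g u v := n.*2 <= wt u + wt v.
pose h v := if v \in X then n <= wt v else ~~ odd n.
have gC u v : g u v = g v u by rewrite /g addnC.
have degX c v : v \in X -> coldeg g h c v =
    (if c then (ix v).+1 else n - (ix v).+1) +
    (if (n./2 <= ix v) == c then d v else 0).
  move=> vX; have lt := ltX v vX.
  have hE : h v = g v v by rewrite /h /g vX; lia.
  rewrite /coldeg -(cardsID X) addnAC; congr (_ + _).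
    rewrite hE.
    (* The color of [v] acts as a loop at [v]: it supplies the term [w = v] that adjacency omits. *)
    transitivity #|[set w in X | g v w == c]|.
      rewrite [RHS](cardsD1 v) !inE vX /= addnC; congr (_ + _).
      apply: eq_card => w; rewrite !inE; case: (eqVneq w v) => [->|wv] /=.
        by rewrite adj_irrefl.
      by case wX: (w \in X); rewrite ?andbF // andbT cliqueX // eq_sym.
    case: c; [transitivity #|[set w in X | n - (ix v).+1 <= ix w]|
             |transitivity #|[set w in X | ix w < n - (ix v).+1]|].
    - by apply: eq_card => w; rewrite !inE; case: (boolP (w \in X)) => //= wX;
        rewrite /g /wt vX wX; lia.
    - by rewrite card_index_ge //; lia.
    - by apply: eq_card => w; rewrite !inE; case: (boolP (w \in X)) => //= wX;
        rewrite /g /wt vX wX; lia.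
    - by rewrite card_index_lt //; lia.
  have gY w : w \notin X -> g v w = (n./2 <= ix v).
    by move=> /negbTE wX; rewrite /g /wt vX wX; lia.
  case: ifP => vc; [apply: eq_card => w | apply: eq_card0 => w]; rewrite !inE.
    by case: (boolP (w \in X)) => wX; rewrite ?andbF //= gY // vc !andbT.
  by case: (boolP (w \in X)) => //= wX; rewrite gY // vc andbF.
have degY c v : v \notin X -> coldeg g h c v <=
    (if c then n - n./2 + ~~ odd n else n./2 + odd n).
  move=> vX; rewrite /coldeg.
  (* This extra 1 makes the bound [n./2 + 1] for red and [n - n./2] for blue, whatever the parity of
     [n]. *)
  have -> : (h v == c) = (if c then ~~ odd n else odd n).
    by rewrite /h (negbTE vX); case: c; case: (odd n).
  have nbX w : adj v w -> w \in X.
    by apply: contraLR => wX; apply: indepX; rewrite inE.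
  have le : #|[set w | adj v w & g v w == c]| <= if c then n - n./2 else n./2.
    have half : n./2 <= #|X| by rewrite -/n; lia.
    have ge_half := card_index_ge s_uniq sX half.
    have lt_half := card_index_lt s_uniq sX half.
    case: c; rewrite -?[leqRHS]ge_half -?[leqRHS]lt_half; apply: subset_leq_card;
      apply/subsetP => w; rewrite !inE => /andP[/nbX wX];
      rewrite wX /g /wt wX (negbTE vX) -/(ix w); lia.
  by move: le; case: c; rewrite leq_add2r.
apply: (tlir_colorable2_fun gC (h := h)).
have case1 u v : u \in X -> v \in X -> ix u < ix v ->
    coldeg g h (g u v) u != coldeg g h (g u v) v.
  move=> uX vX lt; have := ltX v vX; rewrite !degX //.
  have := s_lo u v uX vX; have := s_hi u v uX vX.
  rewrite -/(ix u) -/(ix v).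
  (* Within one half, [d] reinforces the strict order of the clique parts or is absent; across the
     middle it is added only to the larger degree. *)
  case: (leqP n./2 (ix u)) => hu; case: (leqP n./2 (ix v)) => hv /=;
    by case: (g u v) => /=; lia.
have case2 u v : u \in X -> v \notin X -> adj u v ->
    coldeg g h (g u v) u != coldeg g h (g u v) v.
  move=> uX vX uv; have lt := ltX u uX.
  (* The edge to [v] itself lifts the degree of [u] to at least [n./2 + 2] if red and [n - n./2 + 1]
     if blue, one above the bound for [v]. *)
  have d_gt0 : 0 < d u by apply/card_gt0P; exists v; rewrite inE uv.
  have gE : g u v = (n./2 <= ix u) by rewrite /g /wt uX (negbTE vX); lia.
  have := degY (g u v) v vX; rewrite (degX _ u uX) gE eqxx.
  by case: (leqP n./2 (ix u)); lia.
move=> u v uv; case: (boolP (u \in X)) => uX; case: (boolP (v \in X)) => vX.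
- case: (ltngtP (ix u) (ix v)) => [lt|lt|E]; first exact: case1.
    by rewrite eq_sym gC case1.
  have uE : u = v by apply: (index_inj u _ _ E); rewrite sX.
  by move: uv; rewrite uE adj_irrefl.
- exact: case2.
- by rewrite eq_sym gC case2 // adj_sym.
- by have := indepX u v; rewrite !inE uX vX uv => /(_ isT isT).
Qed.

Theorem theorem3 (G : sgraph) (splitG : split_graph G) : tlir G <= 2.
Proof.
case: splitG => X [cliqueX indepX].
rewrite /tlir; case: ex_minnP => m _; apply.
exact: split_tlir_colorable indepX.
Qed.
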